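(* Let $p$ be a prime number, let $\nu\in\mathbb{N}$ with $\nu\ge 1$, and let $u=v=p^{\nu}$. Let $\mathcal{A}=(\mathbb{Z}/v\mathbb{Z};\cdot)$ be the linear cycle set with $\imath\cdot\jmath:=(1-u\imath)\jmath$, and let $\Gamma$ be an additive abelian group. For each $\gamma,\gamma_1\in\Gamma$ such that $v\gamma_1=0$, define maps $\overline{\xi}^1_{\gamma},\overline{\xi}^2_{\gamma_1}\colon \mathbb{Z}/v\mathbb{Z}\times\mathbb{Z}/v\mathbb{Z}\to\Gamma$ by (using representatives $0\le\imath_1,\imath_2<v$) $$\overline{\xi}^1_{\gamma}(\imath_1,\imath_2):=\begin{cases}\gamma&\text{if }\imath_1=\imath_2=1,\\-\gamma&\text{if }\imath_1,\imath_2\ge 2\text{ and }\imath_1+\imath_2\le v+1,\\0&\text{otherwise,}\end{cases}\qquad \overline{\xi}^2_{\gamma_1}(\imath_1,\imath_2):=\imath_1\imath_2\gamma_1 .$$ Then: (1) The set $\Gamma\times\mathbb{Z}/v\mathbb{Z}$ is a linear cycle set via $$(c,\imath)+(c',\imath'):=\bigl(c+c'+\overline{\xi}^1_{\gamma}(\imath,\imath'),\imath+\imath'\bigr),\qquad (c,\imath)\cdot(c',\imath'):=\bigl(c'+\overline{\xi}^2_{\gamma_1}(\imath,\imath'),\imath\cdot\imath'\bigr).$$ Denote this linear cycle set by $\Gamma\oplus_{\overline{\xi}^2_{\gamma_1},\overline{\xi}^1_{\gamma}}\mathbb{Z}/v\mathbb{Z}$. Moreover, with $\iota(c):=(c,0)$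 and $\pi(c,\imath):=\imath$, the sequence $$0\to\Gamma\xrightarrow{\iota}\Gamma\oplus_{\overline{\xi}^2_{\gamma_1},\overline{\xi}^1_{\gamma}}\mathbb{Z}/v\mathbb{Z}\xrightarrow{\pi}\mathbb{Z}/v\mathbb{Z}\to 0$$ is a central extension of $\mathcal{A}$ by $\Gamma$. (2) The extensions associated with $(\overline{\xi}^1_{\gamma},\overline{\xi}^2_{\gamma_1})$ and $(\overline{\xi}^1_{\gamma'},\overline{\xi}^2_{\gamma'_1})$ are equivalent if and only if $\gamma'_1=\gamma_1$ and $v\gamma'=v\gamma$; and each central extension of $\mathcal{A}$ by $\Gamma$ is equivalent to one of these.
   Context: A linear cycle set is an abelian group $(A,+)$ with a binary operation $\cdot$ such that every left translation $a\mapsto a'\cdot a$ is bijective and, for all $a,b,c\in A$, $(a\cdot b)\cdot(a\cdot c)=(b\cdot a)\cdot(b\cdot c)$, $a\cdot(b+c)=a\cdot b+a\cdot c$ and $(a+b)\cdot c=(a\cdot b)\cdot(a\cdot c)$. Morphisms preserve $+$ and $\cdot$. A central extension (in the sense of Lebed and Vendramin) of a linear cycle set $A$ by an abelian group $\Gamma$ is a short exact sequence $0\to\Gamma\xrightarrow{\iota}E\xrightarrow{\pi}A\to0$ of linear cycle sets (i.e. of morphisms of linear cycle sets, exact as a sequence of abelian groups), where $\Gamma$ carries the trivial operation $c\cdot c'=c'$, and $\iota(\Gamma)$ is central in $E$: $\iota(c)\cdot e=e$ and $e\cdot\iota(c)=\iota(c)$ for all $c\in\Gamma$, $e\in E$.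 Two central extensions $E,E'$ of $A$ by $\Gamma$ are equivalent if there is an isomorphism of linear cycle sets $E\to E'$ compatible with the maps from $\Gamma$ and to $A$.
   Formalization: In (2) the condition vγ' = vγ is replaced by γ' − γ ∈ vΓ (same class in Γ/vΓ); as printed it fails in both directions, e.g. Γ = Z, γ = 0, γ' = v (equivalent) and Γ = Z/v, γ = 0, γ' = 1 (not equivalent), with γ₁ = γ₁' = 0. *)

(* Defs.v *)
From mathcomp Require Import all_boot all_order all_algebra.

Set Implicit Arguments.
Unset Strict Implicit.
Unset Printing Implicit Defensive.

Import GRing.Theory.
Local Open Scope ring_scope.

(* Raw data of a linear cycle set; the axioms are the predicate
   [linear_cycle_set] below, so that "this set with these operations is a
   linear cycle set" can be asserted.  No choice structure is required on the
   carrier. *)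
Record lcs_data := LcsData {
  lcs_car :> Type;
  lzero : lcs_car;
  ladd : lcs_car -> lcs_car -> lcs_car;
  ldot : lcs_car -> lcs_car -> lcs_car }.

Arguments lzero {l}.
Arguments ladd {l}.
Arguments ldot {l}.

Definition abelian_group (A : lcs_data) : Prop :=
  [/\ associative (@ladd A), commutative (@ladd A), left_id lzero (@ladd A)
    & exists opp : A -> A, left_inverse lzero opp ladd].

Definition linear_cycle_set (A : lcs_data) : Prop :=
  abelian_group A /\
  [/\ forall a : A, bijective (ldot a),
      forall a b c : A,
        ldot (ldot a b) (ldot a c) = ldot (ldot b a) (ldot b c),
      forall a b c : A, ldot a (ladd b c) = ladd (ldot a b) (ldot a c)
    & forall a b c : A, ldot (ladd a b) c = ldot (ldot a b) (ldot a c)].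

Definition lcs_morphism (A B : lcs_data) (f : A -> B) : Prop :=
  (forall x y : A, f (ladd x y) = ladd (f x) (f y)) /\
  (forall x y : A, f (ldot x y) = ldot (f x) (f y)).

Definition trivial_lcs (G : zmodType) : lcs_data :=
  @LcsData G 0 +%R (fun _ c' => c').

Record extension (G : zmodType) (A : lcs_data) := Extension {
  ext_total : lcs_data;
  ext_inj : G -> ext_total;
  ext_proj : ext_total -> A }.

Definition central_extension (G : zmodType) (A : lcs_data)
    (X : extension G A) : Prop :=
  let E := ext_total X in
  let iota := @ext_inj G A X in
  let pi := @ext_proj G A X in
  [/\ [/\ linear_cycle_set (trivial_lcs G), linear_cycle_set E
        & linear_cycle_set A],
      @lcs_morphism (trivial_lcs G) E iota /\ lcs_morphism pi,
      [/\ injective iota,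
          forall e : E, (exists c : G, iota c = e) <-> pi e = lzero
        & forall a : A, exists e : E, pi e = a]
    & forall (c : G) (e : E),
        ldot (iota c) e = e /\ ldot e (iota c) = iota c].

Definition equivalent_extensions (G : zmodType) (A : lcs_data)
    (X Y : extension G A) : Prop :=
  exists f : ext_total X -> ext_total Y,
    [/\ lcs_morphism f, bijective f,
        forall c : G, f (ext_inj X c) = ext_inj Y c
      & forall e : ext_total X, ext_proj (f e) = ext_proj e].

(* 'Z_v is Z/vZ only for v >= 2. *)
Definition cyclic_lcs (u v : nat) : lcs_data :=
  @LcsData 'Z_v 0 +%R (fun i j => (1 - u%:R * i) * j).

(* The coercion of 'Z_v to nat yields the representative in [0, v). *)
Definition xi1 (v : nat) (G : zmodType) (g : G) (i1 i2 : 'Z_v) : G :=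
  if (nat_of_ord i1 == 1%N) && (nat_of_ord i2 == 1%N) then g
  else if [&& (2 <= i1)%N, (2 <= i2)%N & (i1 + i2 <= v + 1)%N] then - g
  else 0.

Definition xi2 (v : nat) (G : zmodType) (g1 : G) (i1 i2 : 'Z_v) : G :=
  g1 *+ (i1 * i2)%N.

Definition xi_sum (u v : nat) (G : zmodType) (g g1 : G) : lcs_data :=
  @LcsData (G * 'Z_v)%type (0, 0)
    (fun x y => (x.1 + y.1 + xi1 g x.2 y.2, x.2 + y.2))
    (fun x y => (y.1 + xi2 g1 x.2 y.2,
                 @ldot (cyclic_lcs u v) x.2 y.2)).

Definition xi_extension (u v : nat) (G : zmodType) (g g1 : G) :
    extension G (cyclic_lcs u v) :=
  @Extension G (cyclic_lcs u v) (xi_sum u v g g1)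
    (fun c => (c, 0)) (fun x => x.2).

(* Main.v *)
(* Since u = 0 in Z/v, the operation of the base is i . j = j.  Hence in a
   central extension E the elements a . b and b differ by a central element,
   and this difference is biadditive in (a, b).  For a lift e of 1 there are
   thus unique g, g1 with v e = g and e . e = g1 + e, and v g1 = 0 because
   (v e) . e = e.  Conversely g and g1 determine E up to equivalence, and
   replacing e by d + e replaces g by v d + g and leaves g1 unchanged.
   The cocycle xi1 is the one obtained from the section sending i to i e - T i,
   where T i = g if 2 <= i < v and T i = 0 if i < 2. *)
Require Import Defs.
From mathcomp Require Import all_boot all_order all_algebra.
From mathcomp Require Import zify.
From Stdlib Require Import IndefiniteDescription.

Set Implicit Arguments.
Unset Strict Implicit.
Unset Printing Implicit Defensive.

Import GRing.Theory.
Local Open Scope ring_scope.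

(** * Bijections, equivalences and multiples for linear cycle sets *)

(** Carriers are bare types, so the inverse is obtained from [functional_choice]. *)
Lemma inj_surj_bijective (S T : Type) (f : S -> T) :
  injective f -> (forall y, exists x, f x = y) -> bijective f.
Proof.
move=> f_inj /functional_choice [h fK].
by exists h => // x; apply: f_inj; rewrite fK.
Qed.

Lemma equivalent_extensions_sym (G : zmodType) (A : lcs_data)
    (X Y : extension G A) :
  equivalent_extensions X Y -> equivalent_extensions Y X.
Proof.
case=> f [[fD fM] [h fK hK] f_inj f_proj]; exists h; split.
- by split=> x y; apply: (can_inj fK); rewrite ?fD ?fM !hK.
- by exists f.
- by move=> c; rewrite -f_inj fK.
- by move=> y; rewrite -{2}(hK y) f_proj.
Qed.

Definition lmuln (A : lcs_data) (n : nat) (x : A) : A := iter n (ladd x) lzero.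

Lemma lmulnDl (A : lcs_data) (x : A) m n : abelian_group A ->
  lmuln (m + n) x = ladd (lmuln m x) (lmuln n x).
Proof.
case=> addA _ add0 _; elim: m => [|m IHm]; first by rewrite add0.
by rewrite addSn /= IHm addA.
Qed.

Lemma lmulnM (A : lcs_data) (x : A) m n : abelian_group A ->
  lmuln (m * n) x = lmuln m (lmuln n x).
Proof.
move=> abA; elim: m => [|m IHm] //.
by rewrite mulSn lmulnDl // IHm.
Qed.

Lemma laddI (A : lcs_data) (x : A) : abelian_group A -> injective (ladd x).
Proof.
case=> addA _ add0 [opp oppP] y z eq_xyz.
by rewrite -[y]add0 -[z]add0 -(oppP x) -!addA eq_xyz.
Qed.

(** * The cocycles [xi1] and [xi2] *)

(* The [Gamma]-component of the multiple [m (0, 1)] in [xi_sum], so that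
   [xi1 g i j = T (i + j) - T i - T j] with [i + j] computed in nat. *)
Definition gen_cochain (v : nat) (G : zmodType) (g : G) (m : nat) : G :=
  g *+ (m %/ v) + g *+ (1 < m %% v)%N.

Lemma gen_cochain0 v (G : zmodType) (g : G) : gen_cochain v g 0 = 0.
Proof. by rewrite /gen_cochain div0n mod0n addr0. Qed.

Lemma gen_cochain_modn v (G : zmodType) (g : G) m :
  gen_cochain v g m = gen_cochain v g (m %% v) + g *+ (m %/ v).
Proof.
rewrite /gen_cochain modn_mod addrC; congr (_ + _).
by case: v => [|v]; rewrite ?divn0 ?add0r //
  (divn_small (ltn_pmod _ _)) // add0r.
Qed.

(** A carry in [i + j] adds one [g]. For [i, j >= 2] this carry is offset when the remainder is 0 or
    1, that is, for sums v and v + 1; from v + 2 on everything cancels. This explains the bound v +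
    1 in [xi1]. *)
Lemma xi1_coboundary n (G : zmodType) (g : G) (i j : 'Z_n.+2) :
  xi1 g i j = gen_cochain n.+2 g (i + j)%N
              - gen_cochain n.+2 g i - gen_cochain n.+2 g j.
Proof.
have lt_i : (i < n.+2)%N := ltn_ord i; have lt_j : (j < n.+2)%N := ltn_ord j.
have xi1E : xi1 g i j = g *+ ((i == 1 :> nat) && (j == 1 :> nat))
    - g *+ [&& (2 <= i)%N, (2 <= j)%N & (i + j <= n.+2 + 1)%N].
  rewrite /xi1; case: andP => [[/eqP-> _]|_]; first by rewrite subr0.
  by case: ifP => _; rewrite ?subr0 ?sub0r.
rewrite {}xi1E.
move: (nat_of_ord i) (nat_of_ord j) lt_i lt_j => {}i {}j lt_i lt_j.
rewrite /gen_cochain !(divn_small lt_i, divn_small lt_j) !add0r.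
rewrite !(modn_small lt_i, modn_small lt_j).
have -> : ((i + j) %/ n.+2 = (n.+2 <= i + j))%N.
  have [le_n|lt_n] := leqP n.+2 (i + j); last by rewrite divn_small.
  by rewrite -(subnKC le_n) divnDl // divnn divn_small //; lia.
have -> : ((i + j) %% n.+2 = i + j - n.+2 * (n.+2 <= i + j))%N.
  have [le_n|lt_n] := leqP n.+2 (i + j); last by rewrite muln0 subn0 modn_small.
  by rewrite muln1 -{1}(subnKC le_n) modnDl modn_small //; lia.
(* With the negative terms moved across, both sides are natural multiples of [g], and the
   coefficients are compared by case analysis. *)
apply/eqP; rewrite eq_sym !subr_eq eq_sym 2!(addrAC _ (- _)) subr_eq -!mulrnDr.
by apply/eqP; congr (g *+ _); lia.
Qed.

Lemma gen_cochainMD v (G : zmodType) (g : G) q m : (0 < v)%N ->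
  gen_cochain v g (q * v + m) = gen_cochain v g m + g *+ q.
Proof.
by move=> v_gt0; rewrite /gen_cochain divnMDl // modnMDl mulrnDr -addrA addrC.
Qed.

(** Reducing [m] modulo v shifts both values by the same multiple of [g], which cancels in the
    difference. *)
Lemma gen_cochain_modnD v (G : zmodType) (g : G) m k : (0 < v)%N ->
  gen_cochain v g (m %% v + k) - gen_cochain v g (m %% v)
  = gen_cochain v g (m + k) - gen_cochain v g m.
Proof.
move=> v_gt0; rewrite [in RHS](divn_eq m v) -addnA !gen_cochainMD //.
by rewrite [in X in _ = _ - X]addrC addrKA.
Qed.

Lemma xi1C v (G : zmodType) (g : G) (i j : 'Z_v) : xi1 g i j = xi1 g j i.
Proof. by rewrite /xi1 andbC andbCA (addnC i). Qed.

Lemma xi1_cocycle n (G : zmodType) (g : G) (i j k : 'Z_n.+2) :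
  xi1 g i j + xi1 g (i + j) k = xi1 g j k + xi1 g i (j + k).
Proof.
(* Both sides are instances of one expression that is symmetric in the three arguments. *)
suff key (a b c : 'Z_n.+2) : xi1 g a b + xi1 g (a + b) c
    = gen_cochain n.+2 g (a + b + c)%N - gen_cochain n.+2 g a
      - gen_cochain n.+2 g b - gen_cochain n.+2 g c.
  rewrite (xi1C g i (j + k)) !key -addnA [in RHS]addnC.
  by rewrite [RHS](ACl (1 * 4 * 2 * 3)).
have abE : (a + b)%R = ((a + b) %% n.+2)%N :> nat by [].
rewrite !xi1_coboundary abE gen_cochain_modnD //.
move: (gen_cochain _ _ (a + b + c)) (gen_cochain _ _ (a + b)) => y x.
by rewrite !addrA [LHS](ACl (4 * 2 * 3 * 6 * (1 * 5))) /= subrr addr0.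
Qed.

Lemma mulrn_modn (G : zmodType) (g : G) v m :
  g *+ v = 0 -> g *+ (m %% v) = g *+ m.
Proof.
by move=> gv0; rewrite [in RHS](divn_eq m v) mulrnDr mulnC mulrnA gv0 mul0rn add0r.
Qed.

(** As v kills [g], reducing [i + j] modulo v does not affect the multiple. *)
Lemma xi2Dl n (G : zmodType) (g : G) (i j k : 'Z_n.+2) : g *+ n.+2 = 0 ->
  xi2 g (i + j) k = xi2 g i k + xi2 g j k.
Proof.
by move=> g0; rewrite /xi2 /= mulnC mulrnA mulrnAC mulrn_modn // -mulrnAC -mulrnA
  mulnC mulnDl mulrnDr.
Qed.

Lemma xi2C v (G : zmodType) (g : G) (i j : 'Z_v) : xi2 g i j = xi2 g j i.
Proof. by rewrite /xi2 mulnC. Qed.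

(** * The central extension attached to a pair of parameters *)

Lemma cyclic_ldotE n (i j : cyclic_lcs n.+2 n.+2) : ldot i j = j.
Proof. by rewrite /= pchar_Zp // mul0r subr0 mul1r. Qed.

Lemma cyclic_linear_cycle_set n : linear_cycle_set (cyclic_lcs n.+2 n.+2).
Proof.
split.
  split; [exact: addrA|exact: addrC|exact: add0r|].
  by exists -%R; apply: addNr.
split=> *; rewrite ?cyclic_ldotE //.
by exists id => x; rewrite cyclic_ldotE.
Qed.

Lemma trivial_linear_cycle_set (G : zmodType) :
  linear_cycle_set (trivial_lcs G).
Proof.
split.
  split; [exact: addrA|exact: addrC|exact: add0r|].
  by exists -%R; apply: addNr.
by split=> // a; exists id.
Qed.

Lemma xi1_0l v (G : zmodType) (g : G) (i : 'Z_v) : xi1 g 0 i = 0.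
Proof. by []. Qed.

Lemma xi2_0l v (G : zmodType) (g : G) (i : 'Z_v) : xi2 g 0 i = 0.
Proof. by []. Qed.

Lemma xi_sum_ldotE n (G : zmodType) (g g1 : G) (x y : xi_sum n.+2 n.+2 g g1) :
  ldot x y = (y.1 + xi2 g1 x.2 y.2, y.2).
Proof. by have /= -> := cyclic_ldotE x.2 y.2. Qed.

(** [ldot] fixes the second component, so the axioms come down to the symmetry and cocycle identity
    of [xi1] and the biadditivity of [xi2]. *)
Lemma xi_sum_linear_cycle_set n (G : zmodType) (g g1 : G) :
  g1 *+ n.+2 = 0 -> linear_cycle_set (xi_sum n.+2 n.+2 g g1).
Proof.
move=> g1v0; split.
  split.
  - move=> [a i] [b j] [c k] /=; congr (_, _); last exact: addrA.
    rewrite addrA -[LHS]addrA -xi1_cocycle.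
    by rewrite !addrA; congr (_ + _); rewrite addrAC.
  - by move=> [a i] [b j] /=; rewrite xi1C addrC (addrC a b) addrC (addrC i).
  - by move=> [a i] /=; rewrite xi1_0l !add0r addr0.
  (* The extra term cancels the value of [xi1] created by adding [- x.2] to [x.2]. *)
  exists (fun x => (- x.1 - xi1 g (- x.2) x.2, - x.2)).
  by move=> [a i] /=; rewrite addrAC subrK !addNr.
split.
- move=> x; exists (fun y => (y.1 - xi2 g1 x.2 y.2, y.2)) => y;
    by rewrite !xi_sum_ldotE /= ?addrK ?subrK -surjective_pairing.
- by move=> x y z; rewrite !xi_sum_ldotE; congr (_, _); exact: addrAC.
- move=> x y z; rewrite !xi_sum_ldotE /=; congr (_, _).
  rewrite !(xi2C _ x.2) xi2Dl // addrAC -!addrA.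
  by congr (_ + _); rewrite addrCA addrA addrC.
- move=> x y z; rewrite !xi_sum_ldotE /=; congr (_, _).
  by rewrite xi2Dl // addrA addrAC.
Qed.

Lemma xi_extension_central n (G : zmodType) (g g1 : G) :
  g1 *+ n.+2 = 0 -> central_extension (xi_extension n.+2 n.+2 g g1).
Proof.
move=> g1v0; have dotE := @xi_sum_ldotE n G g g1; split.
- split; [exact: trivial_linear_cycle_set|exact: xi_sum_linear_cycle_set|].
  exact: cyclic_linear_cycle_set.
- split; split=> // x y; first by rewrite /= !addr0.
  by apply/esym; rewrite [LHS]dotE /= addr0.
- split=> [a b [] //|[c i]|i] /=.
  + by split=> [[d [_ <-]] //|->]; exists c.
  + by exists (0, i).
- move=> c [d i]; split; rewrite [LHS]dotE /=.
    by rewrite xi2_0l addr0.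
  by rewrite xi2C xi2_0l addr0.
Qed.

(** * Multiples and products in an arbitrary central extension *)

Lemma laddACA (A : lcs_data) : abelian_group A ->
  interchange (@ladd A) (@ladd A).
Proof.
case=> addA addC _ _ a b c d.
by rewrite -!addA; congr (ladd a _); rewrite addA (addC b) -addA.
Qed.

Section CentralExtension.

Variables (n : nat) (G : zmodType) (X : extension G (cyclic_lcs n.+2 n.+2)).
Hypothesis cX : central_extension X.

Let E := ext_total X.
Let iota : G -> E := @ext_inj _ _ X.
Let pi : E -> 'Z_n.+2 := @ext_proj _ _ X.

Let abE : abelian_group E. Proof. by case: cX => [[_ [? _] _]]. Qed.
Let piD a b : pi (ladd a b) = pi a + pi b.
Proof. by case: cX => _ [_ [? _]]. Qed.
Let iotaD x y : iota (x + y) = ladd (iota x) (iota y).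
Proof. by case: cX => _ [[iD _] _] _ _; apply: iD. Qed.
Let dot_iotal c e : ldot (iota c) e = e.
Proof. by case: cX => _ _ _ /(_ c e)[]. Qed.
Let dot_iotar c e : ldot e (iota c) = iota c.
Proof. by case: cX => _ _ _ /(_ c e)[]. Qed.
Let dotDr (a b c : E) : ldot a (ladd b c) = ladd (ldot a b) (ldot a c).
Proof. by case: cX => [[_ [_ []]]]. Qed.
Let dotDl (a b c : E) : ldot (ladd a b) c = ldot (ldot a b) (ldot a c).
Proof. by case: cX => [[_ [_ []]]]. Qed.
Let pi_iota c : pi (iota c) = 0.
Proof. by case: cX => _ _ [_ /(_ (iota c))[+ _] _] _; apply; exists c. Qed.

Lemma ext_inj0 : iota 0 = lzero.
Proof.
apply: (laddI (x := iota 0) abE); rewrite -iotaD addr0.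
by case: abE => _ addC add0 _; rewrite addC add0.
Qed.

Lemma ext_inj_muln x m : iota (x *+ m) = lmuln m (iota x).
Proof.
elim: m => [|m IHm]; first exact: ext_inj0.
by rewrite mulrS iotaD IHm.
Qed.

Lemma ext_proj_muln e m : pi (lmuln m e) = pi e *+ m.
Proof.
(* The zero multiple unfolds to [lzero], which is [iota 0]. *)
elim: m => [|m IHm]; first by rewrite -[lmuln _ _]ext_inj0 pi_iota.
by rewrite /= piD IHm mulrS.
Qed.

(** The difference of [a] and [b] is in the kernel of [pi], hence in the image of [iota]. *)
Lemma ext_fiber a b : pi a = pi b -> exists c, a = ladd (iota c) b.
Proof.
case: abE => addA addC add0 [opp oppP] pi_ab.
have [c def_c] : exists c, iota c = ladd a (opp b).
  case: cX => _ _ [_ /(_ (ladd a (opp b)))[_ +] _] _; apply.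
  by apply: (addIr (pi b)); rewrite -/pi -piD -addA oppP addC add0 add0r.
by exists c; rewrite def_c -addA oppP addC add0.
Qed.

(** With [ext_fiber], this shows that left translation by [a] depends only on [pi a]. *)
Lemma ext_dot_injDl c a b : ldot (ladd (iota c) a) b = ldot a b.
Proof. by rewrite dotDl !dot_iotal. Qed.

Lemma ext_proj_dot a b : pi (ldot a b) = pi b.
Proof.
case: cX => _ [_ [_ dotP]] _ _.
by rewrite /pi dotP cyclic_ldotE.
Qed.

(** Since [ldot a b] and [b] lie in one fiber, they act alike on the left; so [ldot (ladd a b) c] is
    [ldot b (ldot a c)], and [ldot b] fixes [iota x]. *)
Lemma ext_dotDl a b c x y : ldot a c = ladd (iota x) c ->
    ldot b c = ladd (iota y) c ->
  ldot (ladd a b) c = ladd (iota (x + y)) c.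
Proof.
have [z def_ab] := ext_fiber (ext_proj_dot a b) => def_ac def_bc.
rewrite dotDl def_ab ext_dot_injDl def_ac dotDr dot_iotar def_bc iotaD.
by case: abE.
Qed.

Lemma ext_dot_muln e x i j : ldot e e = ladd (iota x) e ->
  ldot (lmuln i e) (lmuln j e) = ladd (iota (x *+ (i * j))) (lmuln j e).
Proof.
move=> def_ee; case: abE => addA addC add0 _.
have def_ie : ldot (lmuln i e) e = ladd (iota (x *+ i)) e.
  elim: i => [|i IHi]; first by rewrite -[lmuln _ _]ext_inj0 dot_iotal ext_inj0 add0.
  by rewrite mulrS; apply: ext_dotDl.
elim: j => [|j IHj].
  by rewrite muln0 -[lmuln 0 _]ext_inj0 dot_iotar -iotaD addr0.
by rewrite dotDr def_ie IHj mulnS mulrnDr iotaD laddACA.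
Qed.

(** The isomorphism sends (c, i) to c - T i + i e: [xi1_coboundary] makes it additive, and
    [ext_dot_muln] makes it respect [ldot]. *)
Lemma xi_extension_equivalent g g1 (e : E) : pi e = 1 ->
    lmuln n.+2 e = iota g -> ldot e e = ladd (iota g1) e ->
  equivalent_extensions (xi_extension n.+2 n.+2 g g1) X.
Proof.
move=> pi_e def_ve def_ee; have [addA addC add0 _] := abE.
have [iota_inj _ _] : [/\ injective iota, True & True] by case: cX => _ _ [].
pose T := gen_cochain n.+2 g.
have lmulnE m : lmuln m e = ladd (iota (g *+ (m %/ n.+2))) (lmuln (m %% n.+2) e).
  by rewrite {1}(divn_eq m n.+2) lmulnDl // lmulnM // def_ve ext_inj_muln.
pose f (x : xi_sum n.+2 n.+2 g g1) : E :=
  ladd (iota (x.1 - T x.2)) (lmuln x.2 e).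
have pi_f x : pi (f x) = x.2.
  by rewrite piD pi_iota add0r ext_proj_muln pi_e natr_Zp.
exists f; split=> //.
- split=> x y.
    rewrite /f laddACA // -iotaD -lmulnDl // [in RHS]lmulnE addA -iotaD.
    congr (ladd (iota _) _); rewrite /= xi1_coboundary.
    (* Reducing the sum modulo v changes [T] by the same multiple of [g] that [lmulnE] splits off
       from the multiple of [e]. *)
    rewrite (gen_cochain_modn _ _ (x.2 + y.2)) -/T.
    rewrite [(Zp_trunc _).+2]/=.
    move: (T (_ %% _)%N) (T x.2) (T y.2) => r s t.
    by rewrite !addrA [LHS](ACl (1 * 5 * 2 * 6 * 4 * (3 * 7))) /= subrr addr0.
  rewrite xi_sum_ldotE /f /= ext_dot_injDl dotDr dot_iotar.
  rewrite (ext_dot_muln _ _ def_ee) addA -iotaD.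
  by congr (ladd (iota _) _); rewrite addrAC.
- apply: inj_surj_bijective => [x y eq_f|y].
    have eq2 : x.2 = y.2 by rewrite -!pi_f eq_f.
    move: eq_f; rewrite /f eq2 !(addC _ (lmuln _ _)) => /(laddI abE)/iota_inj/addIr.
    by case: x y eq2 => [a i] [b j] /= -> ->.
  have [|c ->] := @ext_fiber y (lmuln (pi y) e).
    by rewrite ext_proj_muln pi_e natr_Zp.
  by exists (c + T (pi y), pi y); rewrite /f /= addrK.
- by move=> c; rewrite /f /T /= gen_cochain0 subr0 addC add0.
Qed.

End CentralExtension.

(** * Invariants of the lifts of 1, and the classification *)

Lemma lmuln_morph (A B : lcs_data) (f : A -> B) m x :
  abelian_group A -> abelian_group B -> lcs_morphism f ->
  f (lmuln m x) = lmuln m (f x).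
Proof.
move=> [_ _ addA0 _] abB [fD _].
have f0 : f lzero = lzero.
  apply: (laddI (x := f lzero) abB); rewrite -fD addA0.
  by case: abB => _ addC add0 _; rewrite addC add0.
by elim: m => [|m IHm] //=; rewrite fD IHm.
Qed.

(** Each further summand contributes T (m + 1) - T m, because T 1 = 0, and the sum telescopes. *)
Lemma xi_sum_muln n (G : zmodType) (g g1 d : G) m :
  @lmuln (xi_sum n.+2 n.+2 g g1) m (d, 1)
  = (d *+ m + gen_cochain n.+2 g m, m%:R).
Proof.
elim: m => [|m IHm]; first by rewrite gen_cochain0 addr0.
rewrite /lmuln iterS -/(lmuln _ _) IHm /= xi1_coboundary.
congr (_, _); last by rewrite mulrS.
have mE : nat_of_ord (m%:R : 'Z_n.+2) = (m %% n.+2)%N by rewrite val_Zp_nat.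
have T1 : gen_cochain n.+2 g 1 = 0.
  by rewrite /gen_cochain divn_small ?modn_small ?addr0.
rewrite {}mE {}T1 subr0 addnC gen_cochain_modnD // addn1 mulrS.
move: (gen_cochain _ _ m) (gen_cochain _ _ m.+1) => s t.
by rewrite !addrA addrAC addrK.
Qed.

(** The two invariants of the lift [(d, 1)], by which extensions are compared. *)
Lemma xi_sum_generator n (G : zmodType) (g g1 d : G) :
  let e : xi_sum n.+2 n.+2 g g1 := (d, 1) in
  lmuln n.+2 e = (d *+ n.+2 + g, 0) /\
  ldot e e = ladd ((g1, 0) : xi_sum n.+2 n.+2 g g1) e.
Proof.
split; last by rewrite xi_sum_ldotE /= xi1_0l addr0 add0r addrC.
rewrite xi_sum_muln pchar_Zp // /gen_cochain divnn modnn.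
by rewrite addr0.
Qed.

Theorem theoremA (p nu u v : nat) (p_prime : prime p) (nu_ge1 : (1 <= nu)%N)
    (u_eq : u = (p ^ nu)%N) (v_eq : v = (p ^ nu)%N) (Gamma : zmodType) :
  (forall g g1 : Gamma, g1 *+ v = 0 ->
     linear_cycle_set (xi_sum u v g g1) /\
     central_extension (xi_extension u v g g1))
  /\
  (forall g g1 g' g1' : Gamma, g1 *+ v = 0 -> g1' *+ v = 0 ->
     equivalent_extensions (xi_extension u v g g1) (xi_extension u v g' g1')
     <-> (g1' = g1 /\ exists d : Gamma, g' = g + d *+ v))
  /\
  (forall X : extension Gamma (cyclic_lcs u v), central_extension X ->
     exists g g1 : Gamma,
       g1 *+ v = 0 /\ equivalent_extensions X (xi_extension u v g g1)).
Proof.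
have v_gt1 : (1 < v)%N.
  by rewrite v_eq -(exp1n nu) ltn_exp2r // prime_gt1.
have {u_eq v_eq p_prime nu_ge1 p nu} -> : u = v by rewrite u_eq v_eq.
case: v v_gt1 => [|[|n]] // _.
split; [|split].
- move=> g g1 g1v0; split; first exact: xi_sum_linear_cycle_set.
  exact: xi_extension_central.
- move=> g g1 g' g1' g1v0 g1'v0; split=> [[f [f_morph _ f_iota f_proj]]|].
    have {}f_iota c : f (c, 0) = (c, 0) := f_iota c.
    (* The image of the lift [(0, 1)] is again a lift of 1, so its invariants are known and can be
       matched. *)
    case def_d: (f (0, 1)) => [d i].
    have := f_proj (0, 1); rewrite def_d /= => def_i; rewrite {i}def_i in def_d.
    have [ve ee] := xi_sum_generator n g g1 0.
    have [vfe fefe] := xi_sum_generator n g' g1' d.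
    have [[abE _] [abE' _]] := (xi_sum_linear_cycle_set g g1v0,
                                xi_sum_linear_cycle_set g' g1'v0).
    have := lmuln_morph n.+2 ((0, 1) : xi_sum n.+2 n.+2 g g1) abE abE' f_morph.
    rewrite ve mul0rn add0r f_iota def_d vfe => -[def_g].
    have := congr1 f ee; case: f_morph => fD fM.
    rewrite fM fD f_iota def_d fefe => -[/addIr/addIr def_g1].
    split; first by rewrite def_g1.
    by exists (- d); rewrite def_g mulNrn addrAC subrr add0r.
  case=> -> [d ->].
  (* The lift [(- d, 1)] is chosen so that its v-th multiple is [g] itself. *)
  have [ve ee] := xi_sum_generator n (g + d *+ n.+2) g1 (- d).
  have cX := xi_extension_central (g + d *+ n.+2) g1v0.
  apply: (xi_extension_equivalent cX (e := (- d, 1))) ee => //.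
  by rewrite ve mulNrn (addrC g) addKr.
move=> X cX; have [_ _ [_ _ /(_ 1)[e pi_e]] _] := cX.
have abE : abelian_group (ext_total X) by case: cX => [[_ []]].
have [_ addC add0 _] := abE.
have [|g def_g] := @ext_fiber _ _ _ cX (lmuln n.+2 e) lzero.
  rewrite [LHS](ext_proj_muln cX) pi_e pchar_Zp //.
  exact/esym/(ext_proj_muln cX e 0).
have {}def_g : lmuln n.+2 e = ext_inj X g by rewrite def_g addC add0.
have [g1 def_ee] := ext_fiber cX (ext_proj_dot cX e e).
exists g, g1; split; last first.
  by apply: equivalent_extensions_sym; apply: xi_extension_equivalent def_ee.
(* The product of v e and e is v g1 + e by this formula, and e by centrality of [ext_inj X g];
   cancelling e gives v g1 = 0. *)
have := ext_dot_muln cX n.+2 1 def_ee; rewrite def_g muln1.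
have [_ _ [iota_inj _ _] /(_ g (lmuln 1 e))[-> _]] := cX.
rewrite -{1}[lmuln 1 e]add0 !(addC _ (lmuln 1 e)) => /(laddI abE).
by rewrite -(ext_inj0 cX) => /iota_inj.
Qed.
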